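(* Let $\lambda^{(1)},\dots,\lambda^{(N)}\in\mathfrak h^*$, let $\boldsymbol z=(z_1,\dots,z_N)$ be pairwise distinct complex numbers, let $\boldsymbol l=(l_1,\dots,l_{m+n-1})$ be a tuple of non-negative integers with sum $l$, and let $c:\{1,\dots,l\}\to\{1,\dots,m+n-1\}$ be any function such that $c^{-1}(p)$ has $l_p$ elements for all $p$. If $\boldsymbol t=(t_1,\dots,t_l)\in\mathbb C^l$ satisfies the Bethe equations $$-\sum_{s=1}^N\frac{(\alpha_{c(i)},\lambda^{(s)})}{t_i-z_s}+\sum_{\substack{j=1\\ j\ne i}}^l\frac{(\alpha_{c(i)},\alpha_{c(j)})}{t_i-t_j}=0,\qquad i=1,\dots,l,$$ then the weight function $w(\boldsymbol z,\boldsymbol t)$ belongs to $L(\boldsymbol\lambda)^{\mathrm{sing}}_{\lambda^\infty}$, i.e. it is a singular vector of weight $\lambda^\infty=\sum_{s=1}^N\lambda^{(s)}-\sum_{p=1}^{m+n-1}l_p\alpha_p$ in $L(\boldsymbol\lambda)=L(\lambda^{(1)})\otimes\cdots\otimes L(\lambda^{(N)})$.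
   Context: Lie superalgebra. $\mathbb C^{m|n}$ is the complex superspace with homogeneous basis $e_1,\dots,e_{m+n}$, $m$ of which are even and $n$ odd, in any fixed order subject to $e_1$ being even; $|a|\in\{0,1\}$ is the parity of $e_a$. $\mathfrak{gl}(m|n)$ has basis $E_{ab}$ ($1\le a,b\le m+n$) of parity $|a|+|b|$, with $[E_{ab},E_{cd}]=\delta_{bc}E_{ad}-(-1)^{(|a|+|b|)(|c|+|d|)}\delta_{ad}E_{cb}$. $\mathfrak h$ is spanned by the $E_{aa}$, $\mathfrak n^+$ by the $E_{ab}$ with $a<b$. Let $\epsilon_a\in\mathfrak h^*$ be the basis dual to $E_{aa}$, with bilinear form $(\epsilon_a,\epsilon_b)=(-1)^{|a|}\delta_{ab}$; the simple roots are $\alpha_a=\epsilon_a-\epsilon_{a+1}$, and $F_a=E_{a+1,a}$ has parity $|F_a|$ equal to $|a|+|a+1|$ mod 2, $1\le a\le m+n-1$. $L(\lambda)$ is the irreducible highest weight module with highest weight $\lambda\in\mathfrak h^*$ (with respect to $\mathfrak h\oplus\mathfrak n^+$), with a fixed highest weight vector $v_\lambda$, which is homogeneous for the $\mathbb Z_2$-grading but whose parity is left unspecified. Tensor products follow the super sign rule $(a\otimes b)(v\otimes w)=(-1)^{|b||v|}av\otimes bw$, and $X\in\mathfrak{gl}(m|n)$ acts on tensor products via $\Delta X=X\otimes1+1\otimes X$. A vector is singular if it is annihilated by $\mathfrak n^+$; $L(\boldsymbol\lambda)^{\mathrm{sing}}_{\mu}$ is the space of singular vectors of weight $\mu$. Weight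 function. Let $P_{l,N}$ be the set of ordered partitions: tuples $\boldsymbol n=(n^1_1,\dots,n^1_{p_1};\dots;n^N_1,\dots,n^N_{p_N})$ with $p_k\ge 0$, $p_1+\dots+p_N=l$, whose concatenation is a permutation of $(1,\dots,l)$. Put $$F_{\boldsymbol n}v=F_{c(n^1_1)}\cdots F_{c(n^1_{p_1})}v_{\lambda^{(1)}}\otimes\cdots\otimes F_{c(n^N_1)}\cdots F_{c(n^N_{p_N})}v_{\lambda^{(N)}},$$ $$\omega_{\boldsymbol n}(\boldsymbol z,\boldsymbol t)=\prod_{k=1}^N\frac1{(t_{n^k_1}-t_{n^k_2})\cdots(t_{n^k_{p_k-1}}-t_{n^k_{p_k}})(t_{n^k_{p_k}}-z_k)}$$ (the $k$-th factor is $1$ if $p_k=0$), and let $(-1)^{|\boldsymbol n|}$ be $-1$ to the power of the number of pairs $i<j$ with $|F_{c(i)}|=|F_{c(j)}|=1$ such that $j$ appears before $i$ in the concatenated list. The weight function is $w(\boldsymbol z,\boldsymbol t)=\sum_{\boldsymbol n\in P_{l,N}}(-1)^{|\boldsymbol n|}\omega_{\boldsymbol n}(\boldsymbol z,\boldsymbol t)F_{\boldsymbol n}v$.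
   Formalization: If some F_c(i) is odd, the highest weight vectors of all factors but the last are assumed even (the claim fails otherwise); for arbitrary parities it is proved with the extra super sign (-1)^{sum_{s<k}|F_{n^k}||v_s|} on F_n v. All denominators are assumed nonzero. *)

(* Defs.v *)
From HB Require Import structures.
From mathcomp Require Import all_boot all_order all_algebra.
From mathcomp Require Export reals.
From mathcomp Require Export complex.

Set Implicit Arguments.
Unset Strict Implicit.
Unset Printing Implicit Defensive.

Import GRing.Theory.
Local Open Scope ring_scope.

(* The basis e_1, ..., e_{m+n} of C^{m|n} is indexed by ['I_r.+1], so that
   r = m + n - 1 is the number of simple roots, and [par a] is the parity |a|.
   The elements of gl(m|n) are the matrices ['M[F]_r.+1], and E_ab is
   [delta_mx a b]. Booleans are coerced to nat in the exponents of -1. *)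

Section GeneralLinear.
Variables (F : fieldType) (r : nat) (par : 'I_r.+1 -> bool).

(* Bilinear extension of
   [E_ab, E_cd] = delta_bc E_ad - (-1)^((|a|+|b|)(|c|+|d|)) delta_ad E_cb. *)
Definition gl_bracket (X Y : 'M[F]_r.+1) : 'M[F]_r.+1 :=
  \sum_a \sum_b \sum_c \sum_d (X a b * Y c d) *:
    ((b == c)%:R *: delta_mx a d
     - ((-1) ^+ ((par a + par b) * (par c + par d)) * (a == d)%:R)
         *: delta_mx c b).

Definition gl_homog (p : bool) (X : 'M[F]_r.+1) : Prop :=
  forall a b, X a b != 0 -> par a (+) par b = p.

Definition in_nplus (X : 'M[F]_r.+1) : Prop :=
  forall a b : 'I_r.+1, (b <= a)%N -> X a b = 0.

Definition in_cartan (X : 'M[F]_r.+1) : Prop :=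
  forall a b : 'I_r.+1, a != b -> X a b = 0.

(* A weight is the row of its coordinates in the basis (epsilon_a). *)
Definition weight_eval (mu : 'rV[F]_r.+1) (H : 'M[F]_r.+1) : F :=
  \sum_a mu 0 a * H a a.

Definition weight_form (mu nu : 'rV[F]_r.+1) : F :=
  \sum_a (-1) ^+ par a * mu 0 a * nu 0 a.

Definition lo (p : 'I_r) : 'I_r.+1 := widen_ord (leqnSn r) p.
Definition hi (p : 'I_r) : 'I_r.+1 := lift ord0 p.

Definition simple_root (p : 'I_r) : 'rV[F]_r.+1 :=
  delta_mx 0 (lo p) - delta_mx 0 (hi p).

Definition Fgen (p : 'I_r) : 'M[F]_r.+1 := delta_mx (hi p) (lo p).
Definition Fpar (p : 'I_r) : bool := par (lo p) (+) par (hi p).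

(* The grading V = V_0 + V_1 is given by its two projections [sm_part p]. *)
Record supermodule := Supermodule {
  sm_space :> lmodType F;
  sm_part : bool -> {linear sm_space -> sm_space};
  sm_act : 'M[F]_r.+1 -> {linear sm_space -> sm_space};
  sm_part_sum : forall v, sm_part false v + sm_part true v = v;
  sm_part_proj : forall p q v,
    sm_part p (sm_part q v) = if p == q then sm_part p v else 0;
  sm_act_linear : forall k X Y v,
    sm_act (k *: X + Y) v = k *: sm_act X v + sm_act Y v;
  sm_act_homog : forall p q X v, gl_homog p X ->
    sm_act X (sm_part q v) = sm_part (p (+) q) (sm_act X (sm_part q v));
  sm_act_bracket : forall p q X Y v, gl_homog p X -> gl_homog q Y ->
    sm_act (gl_bracket X Y) v
    = sm_act X (sm_act Y v) - (-1) ^+ (p * q) *: sm_act Y (sm_act X v)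
}.

Definition homog (V : supermodule) (p : bool) (v : V) : Prop :=
  sm_part V p v = v.

Definition singular (V : supermodule) (v : V) : Prop :=
  forall X, in_nplus X -> sm_act V X v = 0.

Definition has_weight (V : supermodule) (mu : 'rV[F]_r.+1) (v : V) : Prop :=
  forall H, in_cartan H -> sm_act V H v = weight_eval mu H *: v.

Definition graded_submodule (V : supermodule) (S : V -> Prop) : Prop :=
  [/\ S 0,
      forall k u v, S u -> S v -> S (k *: u + v),
      forall p v, S v -> S (sm_part V p v)
    & forall X v, S v -> S (sm_act V X v)].

Definition irreducible (V : supermodule) : Prop :=
  (exists v : V, v <> 0) /\
  forall S : V -> Prop, graded_submodule S ->
    (forall v, S v -> v = 0) \/ (forall v, S v).

(* L(lambda) together with v_lambda. It is determined by lambda and by the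
   parity [hw_par] of v_lambda, which is arbitrary. *)
Record irr_hw_module (lambda : 'rV[F]_r.+1) := IrrHwModule {
  hw_module :> supermodule;
  hw_irr : irreducible hw_module;
  hw_vec : hw_module;
  hw_par : bool;
  hw_vec_neq0 : hw_vec <> 0;
  hw_vec_homog : homog hw_par hw_vec;
  hw_vec_singular : singular hw_vec;
  hw_vec_weight : has_weight lambda hw_vec
}.

Definition multilinear (N : nat) (V : 'I_N -> supermodule) (W : lmodType F)
    (f : (forall s, V s) -> W) : Prop :=
  forall (v : forall s, V s) (s : 'I_N) k (x y : V s),
    f (dfwith v (k *: x + y)) = k *: f (dfwith v x) + f (dfwith v y).

(* The tensor product of V_1, ..., V_N: the underlying space with its pure
   tensors is given by the universal property, the total grading is [ts_homog],
   and [ts_act] is the iterated coproduct with the super sign rule: for X and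
   v_1, ..., v_N homogeneous, X (v_1 (x) ... (x) v_N) is the sum over k of
   (-1)^(|X|(|v_1| + ... + |v_{k-1}|)) v_1 (x) ... (x) X v_k (x) ... (x) v_N. *)
Record tensor_product (N : nat) (V : 'I_N -> supermodule) := TensorProduct {
  ts_module :> supermodule;
  tens : (forall s, V s) -> ts_module;
  ts_multilinear : multilinear tens;
  ts_universal : forall (W : lmodType F) (f : (forall s, V s) -> W),
    multilinear f ->
    exists g : {linear ts_module -> W},
      (forall v, g (tens v) = f v) /\
      forall g' : {linear ts_module -> W},
        (forall v, g' (tens v) = f v) -> g' =1 g;
  ts_homog : forall (q : 'I_N -> bool) (v : forall s, V s),
    (forall s, homog (q s) (v s)) ->
    homog (odd (\sum_s q s)) (tens v);
  ts_act : forall p X (q : 'I_N -> bool) (v : forall s, V s),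
    gl_homog p X -> (forall s, homog (q s) (v s)) ->
    sm_act ts_module X (tens v)
    = \sum_(k < N) (-1) ^+ (p * \sum_(s < N | (s < k)%N) q s)
        *: tens (dfwith v (sm_act (V k) X (v k)))
}.

Section WeightFunction.
Variables (N l : nat) (lambda : 'I_N -> 'rV[F]_r.+1).
Variable L : forall s, irr_hw_module (lambda s).
Variable T : tensor_product (fun s => L s : supermodule).
Variables (z : 'I_N -> F) (c : 'I_l -> 'I_r) (t : 'I_l -> F).

(* N-tuples of words in {1, ..., l}; the bound l on the length of each word,
   which makes this a finite type, is no restriction on elements of P_{l,N}. *)
Definition words := {ffun 'I_N -> l.-bseq 'I_l}.

Definition concat (n : words) : seq 'I_l :=
  flatten [seq (n k : seq 'I_l) | k <- enum 'I_N].

Definition ordered_partition (n : words) : bool :=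
  perm_eq (concat n) (enum 'I_l).

Definition Fvec (n : words) : T :=
  tens T (fun k => foldr (fun i u => sm_act (L k) (Fgen (c i)) u)
                         (hw_vec (L k)) (n k)).

Fixpoint omega_factor (zk : F) (s : seq 'I_l) : F :=
  if s is i :: s' then (t i - head zk [seq t j | j <- s'])^-1 * omega_factor zk s'
  else 1.

Definition omega (n : words) : F := \prod_(k < N) omega_factor (z k) (n k).

Definition num_odd_inversions (n : words) : nat :=
  #|[set ij : 'I_l * 'I_l |
      [&& (ij.1 < ij.2)%N, Fpar (c ij.1), Fpar (c ij.2)
        & (index ij.2 (concat n) < index ij.1 (concat n))%N]]|.

Definition weight_function : T :=
  \sum_(n : words | ordered_partition n)
    ((-1) ^+ num_odd_inversions n * omega n) *: Fvec n.

(* Write F_k for the product of the F_{c(i)} along the k-th word. By the super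
   sign rule, (F_1 (x) ... (x) F_N)(v_1 (x) ... (x) v_N) is [Fvec n] times
   (-1)^(sum over s < k of |F_k||v_s|), where v_s is the highest weight
   vector; the sign is 1 when v_1, ..., v_(N-1) are even. *)
Definition koszul_exponent (n : words) : nat :=
  \sum_(k < N) \sum_(s < N | (s < k)%N)
    hw_par (L s) * count (fun i => Fpar (c i)) (n k).

Definition koszul_weight_function : T :=
  \sum_(n : words | ordered_partition n)
    ((-1) ^+ num_odd_inversions n * omega n)
      *: ((-1) ^+ koszul_exponent n *: Fvec n).

Definition bethe_equations : Prop :=
  forall i : 'I_l,
    - (\sum_(s < N) weight_form (simple_root (c i)) (lambda s) / (t i - z s))
    + \sum_(j < l | j != i)
        weight_form (simple_root (c i)) (simple_root (c j)) / (t i - t j) = 0.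

End WeightFunction.
End GeneralLinear.

(* Main.v *)
Require Import Defs.
From mathcomp Require Import all_boot all_order all_algebra.
From mathcomp Require Import boolp ring.

Set Implicit Arguments.
Unset Strict Implicit.
Unset Printing Implicit Defensive.

(* Since n^+ is generated by the simple root vectors E_a = E_{a,a+1}, it suffices
   that E_a kills the weight function w. In E_a F_n v, every letter j with
   c(j) = a is removed once, with the weight (up to a sign (-1)^|a|)
   (alpha_a, lambda^(k) - sum of alpha_{c(i)} over the letters i to the right of j
   in the k-th word). Fix j and a partition n' of the other letters, and collect
   the terms of E_a w where j was inserted somewhere in n'. All of them carry the
   same sign, and since inserting t_j multiplies omega_{n'} by a difference
   1/(t_j - x_q) - 1/(t_j - x_{q-1}), where x_{q-1}, x_q are the neighbours of t_j,
   an Abel summation turns their sum into omega_{n'} times the left-hand side of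
   the j-th Bethe equation, up to sign. *)

Import GRing.Theory.
Local Open Scope ring_scope.

(** * Matrix units, simple root vectors and Cartan brackets *)

Section GeneralLinearFacts.
Variables (F : fieldType) (r : nat) (par : 'I_r.+1 -> bool).
Implicit Types (V : supermodule F par) (a b : 'I_r.+1).

Lemma gl_bracket_delta a b a' b' :
  gl_bracket (F := F) par (delta_mx a b) (delta_mx a' b')
  = (b == a')%:R *: delta_mx a b'
    - ((-1) ^+ ((par a + par b) * (par a' + par b')) * (a == b')%:R)
        *: delta_mx a' b.
Proof.
rewrite /gl_bracket (big_only1 a) //=; last first.
  by move=> i ia _; do 3 rewrite big1 // => ? _;
     rewrite mxE (negPf ia) mul0r scale0r.
rewrite (big_only1 b) //=; last first.
  by move=> i ia _; do 2 rewrite big1 // => ? _;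
     rewrite mxE (negPf ia) andbF mul0r scale0r.
rewrite (big_only1 a') //=; last first.
  by move=> i ia _; rewrite big1 // => ? _;
     rewrite !mxE (negPf ia) mulr0 scale0r.
rewrite (big_only1 b') //=; last first.
  by move=> i ia _; rewrite !mxE (negPf ia) andbF mulr0 scale0r.
by rewrite !mxE !eqxx mul1r scale1r.
Qed.

Lemma gl_homog_delta a b : gl_homog (F := F) par (par a (+) par b) (delta_mx a b).
Proof.
by move=> i j; rewrite mxE; case: (i =P a) => [->|_]; case: (j =P b) => [->|_];
   rewrite /= ?eqxx.
Qed.

Lemma gl_homog_cartan (H : 'M[F]_r.+1) : in_cartan H -> gl_homog par false H.
Proof.
move=> Hc a b; case: (eqVneq a b) => [->|ab]; first by rewrite addbb.
by rewrite Hc ?eqxx.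
Qed.

Lemma sm_act0 V v : sm_act V 0 v = 0.
Proof.
have := sm_act_linear (s := V) 1 0 0 v.
by rewrite !scale1r addr0 => /eqP; rewrite -subr_eq subrr => /eqP.
Qed.

Lemma sm_actZ V k X v : sm_act V (k *: X) v = k *: sm_act V X v.
Proof. by rewrite -[k *: X]addr0 sm_act_linear sm_act0 addr0. Qed.

Lemma sm_actD V X Y v : sm_act V (X + Y) v = sm_act V X v + sm_act V Y v.
Proof. by rewrite -[X]scale1r sm_act_linear !scale1r. Qed.

Lemma sm_act_sum V (I : Type) (s : seq I) (P : pred I) (X : I -> 'M[F]_r.+1) v :
  sm_act V (\sum_(i <- s | P i) X i) v = \sum_(i <- s | P i) sm_act V (X i) v.
Proof.
elim/big_rec2: _ => [|i u A _ <-]; first exact: sm_act0.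
exact: sm_actD.
Qed.

Lemma homog_act V p q X (v : V) :
  gl_homog par p X -> homog q v -> homog (p (+) q) (sm_act V X v).
Proof. by move=> Xp vq; rewrite /homog -vq -sm_act_homog. Qed.

Definition Egen (a : 'I_r) : 'M[F]_r.+1 := delta_mx (lo a) (hi a).

Lemma gl_homog_Egen p : gl_homog par (Fpar par p) (Egen p).
Proof. exact: (@gl_homog_delta _ _). Qed.

Lemma gl_homog_Fgen p : gl_homog par (Fpar par p) (Fgen F p).
Proof. by rewrite /Fpar addbC; exact: (@gl_homog_delta _ _). Qed.

(** By induction on the height b - a: a non-simple E_{ab} is the bracket of E_{a,b-1} with the
    simple E_{b-1,b}, and both of these already kill v. *)
Lemma singular_simple V (v : V) :
  (forall p, sm_act V (Egen p) v = 0) -> singular v.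
Proof.
move=> Ev X Xn.
have Eab d a b : b = (a + d).+1 :> nat -> sm_act V (delta_mx a b) v = 0.
  elim: d b => [|d IHd] b bE.
    have ar : (a < r)%N by have := ltn_ord b; rewrite bE addn0.
    have -> : a = lo (Ordinal ar) by apply/val_inj.
    have -> : b = hi (Ordinal ar) by apply/val_inj; rewrite /= bE addn0.
    exact: Ev.
  have br : (a + d.+1 < r)%N by have := ltn_ord b; rewrite bE ltnS.
  pose e := Ordinal br.
  have bh : b = hi e by apply/val_inj; rewrite /= bE.
  have al : a != hi e.
    by rewrite -val_eqE /= /bump /= add1n neq_ltn ltnS leq_addr.
  have := gl_bracket_delta a (lo e) (lo e) (hi e).
  rewrite eqxx (negPf al) mulr0 scale0r subr0 scale1r -bh => <-.
  rewrite (sm_act_bracket _ (@gl_homog_delta _ _) (@gl_homog_delta _ _)).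
  by rewrite bh Ev IHd /= ?addnS // !raddf0 addr0.
rewrite [X]matrix_sum_delta sm_act_sum big1 // => a _.
rewrite sm_act_sum big1 // => b _; rewrite sm_actZ.
have [ba|ab] := leqP b a; first by rewrite Xn // scale0r.
by rewrite (Eab (b - a.+1)%N) ?scaler0 // -addSn subnKC.
Qed.

Lemma lo_inj : injective (@lo r).
Proof. by move=> i j /(congr1 val) /= ij; apply/val_inj. Qed.

Lemma hi_inj : injective (@hi r).
Proof. exact: lift_inj. Qed.

(** The bracket is E_{aa} - (-1)^{|F_a|} E_{a+1,a+1}. As the form carries the sign (-1)^{|b|} on
    epsilon_b, taking out (-1)^{|a|} leaves the pairing of [mu] with the simple root. *)
Lemma weight_eval_bracket (mu : 'rV[F]_r.+1) (a : 'I_r) :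
  weight_eval mu (gl_bracket par (Egen a) (Fgen F a))
  = (-1) ^+ par (lo a) * weight_form par (simple_root F a) mu.
Proof.
have lh : lo a != hi a by rewrite -val_eqE /= /bump /= add1n neq_ltn ltnSn.
have form_delta b :
    weight_form par (delta_mx 0 b) mu = (-1) ^+ par b * mu 0 b.
  rewrite /weight_form (big_only1 b) //=; first by rewrite mxE !eqxx mulr1.
  by move=> i ib _; rewrite mxE (negPf ib) mulr0 mul0r.
have -> : weight_form par (simple_root F a) mu
    = (-1) ^+ par (lo a) * mu 0 (lo a) - (-1) ^+ par (hi a) * mu 0 (hi a).
  rewrite -!form_delta -sumrB; apply: eq_bigr => i _.
  by rewrite /simple_root !mxE mulrBr mulrBl.
rewrite gl_bracket_delta !eqxx scale1r mulr1 /weight_eval.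
rewrite (bigD1 (lo a)) // (bigD1 (hi a)) 1?eq_sym //= big1 => [|i].
  rewrite !mxE !eqxx (negPf lh) eq_sym (negPf lh) /=.
  by case: (par (lo a)); case: (par (hi a)); rewrite /=; ring.
move=> /andP [ih il]; rewrite !mxE (negPf ih) (negPf il) /=; ring.
Qed.

Lemma in_cartan_bracket (a : 'I_r) :
  in_cartan (gl_bracket par (Egen a) (Fgen F a)).
Proof.
move=> i j ij; have diag b : (i == b) && (j == b) = false.
  by apply/andP => -[/eqP ib /eqP jb]; rewrite ib jb eqxx in ij.
by rewrite gl_bracket_delta !mxE !diag !mulr0 subrr.
Qed.
End GeneralLinearFacts.

(** * Inserting a letter into a word, and the parity of odd inversions *)

Section Insertion.
Variables (l : nat).
Implicit Types (j : 'I_l) (s : seq 'I_l).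

Definition insert q j s := take q s ++ j :: drop q s.

Lemma size_insert q j s : size (insert q j s) = (size s).+1.
Proof. by rewrite size_cat /= addnS -size_cat cat_take_drop. Qed.

Lemma perm_insert q j s : perm_eq (insert q j s) (j :: s).
Proof.
by rewrite /insert -cat1s perm_catCA perm_cons cat_take_drop.
Qed.

Lemma index_insert q j s :
  j \notin s -> (q <= size s)%N -> index j (insert q j s) = q.
Proof.
move=> js qs; rewrite index_cat (contraNF (@mem_take _ _ _ _) js).
by rewrite /= eqxx addn0 size_takel.
Qed.

Lemma insert_rem j s : j \in s -> insert (index j s) j (rem j s) = s.
Proof.
move=> js; rewrite remE /insert take_size_cat ?size_takel ?index_size //.
rewrite drop_size_cat ?size_takel ?index_size //.
by rewrite -[in RHS](cat_take_drop (index j s) s) (drop_nth j)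
  ?index_mem // nth_index.
Qed.

Lemma take_insert q j s :
  (q <= size s)%N -> take q (insert q j s) = take q s.
Proof. by move=> qs; rewrite take_size_cat ?size_takel. Qed.

Lemma drop_insert q j s :
  (q <= size s)%N -> drop q.+1 (insert q j s) = drop q s.
Proof.
by move=> qs; rewrite /insert -cat_rcons drop_size_cat // size_rcons size_takel.
Qed.

Lemma rem_insert q j s :
  j \notin s -> (q <= size s)%N -> rem j (insert q j s) = s.
Proof.
move=> js qs.
by rewrite remE index_insert // take_insert // drop_insert // cat_take_drop.
Qed.

Section OddInversions.
Variable o : pred 'I_l.

(** A recursive form of [num_odd_inversions], suited to induction on the letters that precede an
    inserted one. *)
Fixpoint odd_inv s :=
  if s is x :: s' then
    (o x * count (fun y : 'I_l => (y < x)%N && o y) s' + odd_inv s')%N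
  else 0%N.

(* Among the odd letters other than [j], those preceding [j] while being smaller
   and those following [j] while being larger are, modulo 2, traded for one
   another by adding the letters preceding [j]; so the position of [j] drops
   out. *)
Lemma odd_inv_insert s1 j s2 : j \notin s1 ->
  odd (odd_inv (s1 ++ j :: s2) + o j * count o s1)
  = odd (odd_inv (s1 ++ s2)
         + o j * count (fun y : 'I_l => (y < j)%N && o y) (s1 ++ s2)).
Proof.
elim: s1 => [_|x s1 IHs]; first by rewrite /= muln0 addn0 addnC.
rewrite inE negb_or => /andP [jx /IHs {}IHs] /=; move: IHs jx.
rewrite -val_eqE /= !count_cat /= !(oddD, oddM, oddb).
move: (odd (odd_inv (s1 ++ j :: s2))) (odd (odd_inv (s1 ++ s2))).
do 5!move: (odd (count _ _)).
by case: (ltngtP j x) => _; case: (o j); case: (o x); do 7!case.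
Qed.

(** The inversions are split by whether their earlier entry is the head of the word. An absent
    letter has index [size s], so membership of [ij.1] must be required; that of [ij.2] then follows
    from its smaller index. *)
Lemma card_odd_inv s : uniq s ->
  #|[set ij : 'I_l * 'I_l | (ij.1 \in s) && [&& (ij.1 < ij.2)%N, o ij.1, o ij.2
      & (index ij.2 s < index ij.1 s)%N]]| = odd_inv s.
Proof.
elim: s => [|x s IHs] /=; first by rewrite eq_card0 // => ij; rewrite inE.
case/andP => xs us; rewrite -IHs //.
pose D := [seq y : 'I_l <- s | [&& (y < x)%N, o y & o x]].
have -> : (o x * count (fun y : 'I_l => (y < x)%N && o y) s)%N
    = #|[set (y, x) | y in D]|.
  rewrite card_imset => [|y y' [] //].
  rewrite (card_uniqP _) ?filter_uniq // size_filter.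
  case: (o x); first by rewrite mul1n; apply: eq_count => y; rewrite andbT.
  by rewrite mul0n (eq_count (a2 := pred0)) ?count_pred0 // => y; rewrite !andbF.
rewrite -cardsUI (_ : _ :&: _ = set0) ?cards0 ?addn0; last first.
  apply/setP => -[y y']; rewrite !inE; apply/negP => /andP [].
  case/imsetP => y0 _ [_ ->]; rewrite memNindex // => /and4P [_ _ _].
  by case/andP => _; rewrite ltnNge index_size.
apply: eq_card => -[y y']; rewrite !inE /=.
have -> : ((y, y') \in [set (y0, x) | y0 in D]) = (y' == x) && (y \in D).
  apply/imsetP/andP => [[y0 y0D [-> ->]] //|[/eqP -> yD]]; by exists y.
rewrite mem_filter; have [->|yx] := eqVneq y x.
  by rewrite ltn0 (negPf xs) !andbF.
have [->|y'x] := eqVneq y' x.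
  rewrite [(index x s < _)%N]ltnNge (memNindex xs) index_size ltn0Sn /=.
  by case: (y \in s); rewrite /= ?andbF ?orbF ?andbT.
by rewrite ltnS.
Qed.
End OddInversions.
End Insertion.

(** The Abel summation, done by induction on the word. [Lam] and [be] stand for the pairings of a
    simple root with the highest weight and with the roots of the letters. *)
Lemma omega_insert (F : fieldType) l (t : 'I_l -> F) (zk : F) (be : 'I_l -> F)
    (Lam : F) j s :
  injective t -> (forall i, t i != zk) -> uniq (j :: s) ->
  \sum_(q < (size s).+1)
     omega_factor t zk (insert q j s) * (Lam - \sum_(i <- drop q s) be i)
  = omega_factor t zk s
    * (Lam / (t j - zk) - \sum_(i <- s) be i / (t j - t i)).
Proof.
move=> tI tz; elim: s => [_|i s IHs] /=.
  by rewrite big_ord_recl big_ord0 /= !big_nil addr0 /= !subr0 mulr1 mul1r mulrC.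
rewrite inE negb_or -andbA => /and4P [ji js is_ us].
have {}IHs := IHs _; rewrite /= js us in IHs; have {}IHs := IHs isT.
rewrite big_ord_recl /= big_ord_recl /= !big_cons.
set x := head zk _ in IHs *.
rewrite big_ord_recl /= in IHs.
have nz u v : u != v -> t u - t v != 0 by rewrite subr_eq0 (inj_eq tI).
have tx u : u \notin s -> t u - x != 0.
  rewrite /x; case: (s) => [|v s'] /=; rewrite subr_eq0 ?tz //.
  by rewrite inE negb_or (inj_eq tI) => /andP [].
move: IHs; rewrite /insert !take0 !drop0 /=.
rewrite -/x.
(* If [j] is inserted after the first letter of [s], the right neighbour of [i] keeps its value x,
   so 1/(t_i - x) factors out. The induction hypothesis then eliminates the remaining sum in favour
   of the insertion in front of [s]. *)
under [X in _ -> _ + (_ + X) = _]eq_bigr => q _.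
  have -> : head zk [seq t j0 | j0 <- take q.+1 s ++ j :: drop q.+1 s] = x.
    by rewrite /x; case: (s) q => [|? ?] [].
  rewrite -mulrA; over.
rewrite -mulr_sumr => /(canRL (addKr _)) ->.
have := nz _ _ ji; have := tx _ js; have := tx _ is_.
have := nz i j; rewrite eq_sym ji => /(_ isT).
have : t j - zk != 0 by rewrite subr_eq0.
(* What is left is a partial fraction identity in which the two sums over [s] are mere
   indeterminates. *)
move: (t i) (t j) (x) tx (\sum_(_ <- s) be _) (\sum_(_ <- s) _ / _) => a b y _ B C.
by move=> h1 h2 h3 h4 h5; field; apply/and5P.
Qed.

(** * Replacing one word in a tuple of words *)

Section Words.
Variables (N l : nat).
Implicit Types (n : words N l) (k : 'I_N) (w : seq 'I_l).

(** A word longer than l is replaced by a default value, hence the size conditions wherever [w] is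
    read back. *)
Definition upd n k w : words N l :=
  [ffun s => if s == k then insub_bseq l w else n s].

Lemma upd_same n k w : (size w <= l)%N -> upd n k w k = w :> seq _.
Proof. by move=> wl; rewrite ffunE eqxx insubdK. Qed.

Lemma upd_other n k w s : s != k -> upd n k w s = n s.
Proof. by move=> sk; rewrite ffunE (negPf sk). Qed.

Lemma upd_upd n k w w' : upd (upd n k w) k w' = upd n k w'.
Proof. by apply/ffunP => s; rewrite !ffunE; case: eqP. Qed.

Lemma upd_id n k : upd n k (n k) = n.
Proof.
apply/ffunP => s; rewrite ffunE; case: eqP => // ->.
by apply/val_inj; rewrite /= insubdK // -topredE /= size_bseq.
Qed.

(** The context [w1], [w2] does not depend on [w]. Counting odd letters in [w1] yields the letter
    part of the sign that an operator picks up on its way to the k-th factor. *)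
Lemma concat_upd n k : exists w1 w2,
  (forall w, (size w <= l)%N -> concat (upd n k w) = w1 ++ w ++ w2) /\
  (forall o : pred 'I_l,
     count o w1 = (\sum_(s < N | (s < k)%N) count o (n s))%N).
Proof.
pose e := enum 'I_N.
have eE : e = take k e ++ k :: drop k.+1 e.
  by rewrite -{1}(cat_take_drop k e) (drop_nth k) ?nth_ord_enum ?size_enum_ord.
have ue : uniq e by exact: enum_uniq.
move: (ue); rewrite {1}eE cat_uniq /= negb_or.
case/and4P => _ /andP [k1 _] k2 _.
exists (flatten [seq (n s : seq _) | s <- take k e]),
       (flatten [seq (n s : seq _) | s <- drop k.+1 e]); split.
  move=> w wl; rewrite /concat -/e {1}eE map_cat flatten_cat /= upd_same //.
  congr (flatten _ ++ (_ ++ flatten _)); apply/eq_in_map => s se.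
    by rewrite upd_other //; apply: contraNneq k1 => sk; rewrite sk in se.
  by rewrite upd_other //; apply: contraNneq k2 => sk; rewrite sk in se.
move=> o; rewrite count_flatten -map_comp sumnE big_map big_uniq ?take_uniq //=.
by apply: eq_bigl => s; rewrite in_take ?mem_enum // index_enum_ord.
Qed.

Lemma num_odd_inversionsE r par (c : 'I_l -> 'I_r) n : ordered_partition n ->
  num_odd_inversions par c n = odd_inv (fun i => Fpar par (c i)) (concat n).
Proof.
move=> nP; rewrite -card_odd_inv; last by rewrite (perm_uniq nP) enum_uniq.
apply: eq_card => ij; rewrite !inE.
by rewrite (perm_mem nP) mem_enum.
Qed.

End Words.

(** * Weights and the action of E_a in a single tensor factor *)

Section WordVectors.
Variables (F : fieldType) (r l : nat) (par : 'I_r.+1 -> bool) (c : 'I_l -> 'I_r).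
Variables (lam : 'rV[F]_r.+1) (M : irr_hw_module par lam).
Implicit Types (s : seq 'I_l) (a : 'I_r).

Let odd_letter i := Fpar par (c i).

Definition word_vec s : M :=
  foldr (fun i u => sm_act M (Fgen F (c i)) u) (hw_vec M) s.

Definition word_weight s := lam - \sum_(i <- s) simple_root F (c i).

Lemma word_vec_homog s :
  homog (hw_par M (+) odd (count odd_letter s)) (word_vec s).
Proof.
elim: s => [|i s IHs]; first by rewrite addbF; exact: hw_vec_homog.
by rewrite /= oddD oddb addbCA; apply: homog_act IHs; apply: gl_homog_Fgen.
Qed.

Lemma has_weight_diag (V : supermodule F par) (mu : 'rV[F]_r.+1) (v : V) :
  (forall b, sm_act V (delta_mx b b) v = mu 0 b *: v) -> has_weight mu v.
Proof.
move=> vd H Hc.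
have -> : H = \sum_b H b b *: delta_mx b b.
  rewrite [LHS]matrix_sum_delta; apply: eq_bigr => b _.
  by rewrite (big_only1 b) // => b' bb' _; rewrite Hc ?scale0r // eq_sym.
rewrite sm_act_sum; under eq_bigr do rewrite sm_actZ vd scalerA.
rewrite -scaler_suml; congr (_ *: _); rewrite /weight_eval; apply: eq_bigr => b _.
rewrite summxE (big_only1 b) //= => [|b' bb' _].
  by rewrite !mxE !eqxx mulr1 mulrC.
by rewrite !mxE eq_sym (negPf bb') mulr0.
Qed.

Lemma word_vec_weight s : has_weight (word_weight s) (word_vec s).
Proof.
elim: s => [|i s IHs].
  by rewrite /word_weight big_nil subr0; exact: hw_vec_weight.
apply: has_weight_diag => b /=.
have cb : in_cartan (delta_mx b b : 'M[F]_r.+1).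
  move=> i' j' ij; rewrite mxE; case: (i' =P b) => // ib; case: (j' =P b) => // jb.
  by rewrite ib jb eqxx in ij.
have := sm_act_bracket (s := M) (word_vec s) (gl_homog_cartan par cb)
  (@gl_homog_Fgen F r par (c i)).
rewrite mul0n expr0 scale1r => /esym/eqP; rewrite subr_eq => /eqP ->.
have eb : weight_eval (word_weight s) (delta_mx b b) = word_weight s 0 b.
  rewrite /weight_eval (big_only1 b) //= => [|b' bb' _].
    by rewrite [delta_mx _ _ _ _]mxE !eqxx mulr1.
  by rewrite [delta_mx _ _ _ _]mxE (negPf bb') mulr0.
rewrite (IHs _ cb) eb linearZ /= gl_bracket_delta.
have -> : (-1 : F) ^+ ((par b + par b) * (par (hi (c i)) + par (lo (c i)))) = 1.
  by rewrite -signr_odd oddM addnn odd_double.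
have -> : word_weight (i :: s) = word_weight s - simple_root F (c i).
  by rewrite /word_weight big_cons opprD addrA addrAC.
have -> : (word_weight s - simple_root F (c i)) 0 b
    = word_weight s 0 b - simple_root F (c i) 0 b by rewrite !mxE.
rewrite mul1r -scaleNr sm_actD !sm_actZ [RHS]scalerBl addrC; congr (_ + _).
rewrite !mxE !eqxx /= scalerBl opprB addrC -scaleNr.
rewrite [RHS]addrC; congr (_ + _); case: eqP => [->|_] //=;
by rewrite ?mulr0n ?oppr0 !scale0r.
Qed.

Lemma weight_form_sub (mu nu nu' : 'rV[F]_r.+1) :
  weight_form par mu (nu - nu')
  = weight_form par mu nu - weight_form par mu nu'.
Proof.
by rewrite /weight_form -sumrB; apply: eq_bigr => b _; rewrite !mxE mulrBr.
Qed.

Lemma weight_form_sum (mu : 'rV[F]_r.+1) (I : Type) (s : seq I)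
    (nu : I -> 'rV[F]_r.+1) :
  weight_form par mu (\sum_(i <- s) nu i) = \sum_(i <- s) weight_form par mu (nu i).
Proof.
rewrite /weight_form exchange_big /=; apply: eq_bigr => b _.
by rewrite summxE mulr_sumr.
Qed.

(* [E_a, F_a] acts on [word_vec s] by this scalar times (-1)^|a|. *)
Definition cut_weight a (s : seq 'I_l) : F :=
  weight_form par (simple_root F a) lam
  - \sum_(i <- s) weight_form par (simple_root F a) (simple_root F (c i)).

(** E_a is moved to the right until it kills the highest weight vector. Passing a letter costs the
    sign (-1)^{|F_a||F_{c(i)}|}; a commutator survives only at letters with c(j) = a, where a Cartan
    element acts by the weight of the suffix after j. *)
Lemma Egen_word_vec a s : uniq s ->
  sm_act M (Egen F a) (word_vec s)
  = \sum_(j <- s | c j == a)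
      ((-1) ^+ (Fpar par a * count odd_letter (take (index j s) s))
       * ((-1) ^+ par (lo a) * cut_weight a (drop (index j s).+1 s)))
      *: word_vec (rem j s).
Proof.
elim: s => [_|i s IHs] /=.
  rewrite big_nil; apply: hw_vec_singular => x y yx; rewrite mxE.
  case: eqP yx => [->|] //; case: eqP => [->|] //.
  by rewrite /= /bump /= add1n ltnn.
case/andP => is_ us; have {}IHs := IHs us.
have := sm_act_bracket (s := M) (word_vec s) (@gl_homog_Egen F r par a)
  (@gl_homog_Fgen F r par (c i)).
move=> /esym/eqP; rewrite subr_eq => /eqP ->.
rewrite IHs linear_sum /= scaler_sumr big_cons /= eqxx take0 drop0 muln0 mul1r.
have -> : \sum_(j <- s | c j == a)
      ((-1) ^+ (Fpar par a * count odd_letter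
                  (take (if i == j then 0%N else (index j s).+1) (i :: s)))
       * ((-1) ^+ par (lo a)
          * cut_weight a (drop (if i == j then 0%N else (index j s).+1) s)))
      *: word_vec (if i == j then s else i :: rem j s)
   = \sum_(j <- s | c j == a) (-1) ^+ (Fpar par a * Fpar par (c i)) *:
       sm_act M (Fgen F (c i))
         (((-1) ^+ (Fpar par a * count odd_letter (take (index j s) s)) *
          ((-1) ^+ par (lo a) * cut_weight a (drop (index j s).+1 s))) *:
         word_vec (rem j s)).
  rewrite big_seq_cond [RHS]big_seq_cond; apply: eq_bigr => j /andP [js _].
  have /negPf -> : i != j by apply: contraNneq is_ => ->.
  by rewrite linearZ scalerA /= mulnDr exprD -mulrA.
case: (c i =P a) => [<-|ca].
  rewrite (word_vec_weight s (in_cartan_bracket F par (c i))).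
  by rewrite weight_eval_bracket weight_form_sub weight_form_sum.
have ac : a != c i by apply/eqP => ac; case: ca.
rewrite gl_bracket_delta (inj_eq (@hi_inj r)) (inj_eq (@lo_inj r)) (negPf ac).
by rewrite mulr0 !scale0r subrr sm_act0 add0r.
Qed.

End WordVectors.

(** * Ordered partitions with one letter removed *)

Section Removal.
Variables (N l : nat).
Implicit Types (n : words N l) (k : 'I_N) (j : 'I_l).

Lemma uniq_word n k : uniq (concat n) -> uniq (n k).
Proof.
have [w1 [w2 [cE _]]] := concat_upd n k.
rewrite -{1}(upd_id n k) cE ?size_bseq // cat_uniq => /and3P [_ _].
by rewrite cat_uniq => /and3P [].
Qed.

Lemma sum_concat (V : nmodType) n (f : 'I_l -> V) :
  \sum_(i <- concat n) f i = \sum_(k < N) \sum_(i <- n k) f i.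
Proof. by rewrite /concat big_flatten big_map big_enum. Qed.

Definition partition_without j n := perm_eq (j :: concat n) (enum 'I_l).

Lemma perm_concat_insert j n k q : (size (n k) < l)%N ->
  perm_eq (concat (upd n k (insert q j (n k)))) (j :: concat n).
Proof.
move=> szl; have [w1 [w2 [cE _]]] := concat_upd n k.
rewrite cE ?size_insert // -[in X in perm_eq _ X](upd_id n k) cE ?size_bseq //.
apply: (@perm_trans _ (w1 ++ [:: j] ++ n k ++ w2)); last by rewrite perm_catCA.
by rewrite perm_cat2l catA perm_cat2r perm_insert.
Qed.

Lemma partition_without_notin j n : partition_without j n -> j \notin concat n.
Proof.
by move=> nP; have := enum_uniq 'I_l; rewrite -(perm_uniq nP) => /andP [].
Qed.

(** This leaves room for [j], so that an insertion never exceeds the length bound built into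
    [words]. *)
Lemma size_without j n k : partition_without j n -> (size (n k) < l)%N.
Proof.
move=> /perm_size; rewrite size_enum_ord /= => lE.
suff: (size (n k) <= size (concat n))%N by rewrite -ltnS lE.
have [w1 [w2 [cE _]]] := concat_upd n k.
rewrite -[in X in (_ <= X)%N](upd_id n k) cE ?size_bseq // !size_cat.
by rewrite addnCA leq_addr.
Qed.

Lemma notin_without j n k : partition_without j n -> j \notin n k.
Proof.
move=> /partition_without_notin; have [w1 [w2 [cE _]]] := concat_upd n k.
by rewrite -{1}(upd_id n k) cE ?size_bseq // !mem_cat !negb_or => /and3P [].
Qed.

(** The bijection sends a partition to its word tuple without [j], together with the position that
    [j] had in the k-th word. *)
Lemma big_insert (V : nmodType) j k (G : words N l -> V) :
  \sum_(n | ordered_partition n && (j \in (n k : seq _))) G n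
  = \sum_(n | partition_without j n)
      \sum_(q < (size (n k)).+1) G (upd n k (insert q j (n k))).
Proof.
(* The range of q depends on n; widening it to a fixed ordinal type makes the double sum a sum over
   pairs. *)
under [RHS]eq_bigr => n _ do
  rewrite (big_ord_widen l.+1 (fun q => G (upd n k (insert q j (n k)))))
    ?ltnS ?size_bseq //.
rewrite pair_big_dep /=.
rewrite (reindex_onto
  (fun p : words N l * 'I_l.+1 => upd p.1 k (insert p.2 j (p.1 k)))
  (fun n => (upd n k (rem j (n k)), inord (index j (n k))))) /=.
  apply: eq_bigl => -[n q] /=; apply/andP/andP => [[/andP [nP jn]]|[nP qs]].
    (* A q beyond the end of the word would still insert at the end; the round trip condition rules
       this out by forcing q to be the actual index of [j]. *)
    set h := upd n k _ in nP jn *; rewrite {1}/h upd_upd => /eqP [nE qE].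
    have hE : n k = rem j (h k) :> seq _.
      by rewrite -{1}nE upd_same // size_rem // (leq_trans (leq_pred _)) ?size_bseq.
    have jl : (index j (h k) < size (h k))%N by rewrite index_mem.
    have sl : (size (n k) < l)%N.
      by rewrite hE size_rem // prednK ?size_bseq //; apply: leq_ltn_trans jl.
    have qv : q = index j (h k) :> nat.
      by rewrite -{1}qE inordK // ltnS (leq_trans (index_size _ _)) ?size_bseq.
    have qs : (q < (size (n k)).+1)%N.
      by rewrite qv hE size_rem // prednK //; apply: leq_ltn_trans jl.
    split=> //.
    by rewrite /partition_without -(permPl (perm_concat_insert j q sl)).
  have ql : (q <= size (n k))%N by [].
  have jn := notin_without k nP.
  have sl := size_without k nP.
  rewrite upd_same ?size_insert // upd_upd rem_insert // upd_id.
  rewrite index_insert // inord_val eqxx (perm_mem (perm_insert _ _ _)).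
  rewrite inE eqxx andbT; split=> //.
  by rewrite /ordered_partition (permPl (perm_concat_insert j q sl)).
move=> n /andP [nP jn].
have jl : (index j (n k) < l.+1)%N.
  by rewrite ltnS (leq_trans (index_size _ _)) ?size_bseq.
have sr : (size (rem j (n k)) <= l)%N.
  by rewrite size_rem // (leq_trans (leq_pred _)) ?size_bseq.
by rewrite upd_upd inordK // upd_same // insert_rem // upd_id.
Qed.

End Removal.

(** * The action on pure tensors of word vectors *)

Section Tensor.
Variables (F : fieldType) (r : nat) (par : 'I_r.+1 -> bool) (N l : nat).
Variables (lambda : 'I_N -> 'rV[F]_r.+1).
Variable L : forall s, irr_hw_module par (lambda s).
Variable T : tensor_product (fun s => L s : supermodule F par).
Variables (z : 'I_N -> F) (c : 'I_l -> 'I_r) (t : 'I_l -> F).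
Implicit Types (n : words N l) (k : 'I_N) (j : 'I_l) (a : 'I_r).

Let odd_letter i := Fpar par (c i).
Let word_vecs n : forall s, L s := fun s => word_vec c (L s) (n s).

Lemma tens_lin (v : forall s, L s) k (I : Type) (s : seq I) (P : pred I)
    (x : I -> F) (u : I -> L k) :
  tens T (dfwith v (\sum_(i <- s | P i) x i *: u i))
  = \sum_(i <- s | P i) x i *: tens T (dfwith v (u i)).
Proof.
have lin := @ts_multilinear _ _ _ _ _ T v k.
have t0 : tens T (dfwith v (0 : L k)) = 0.
  have := lin 1 0 0; rewrite !scale1r addr0 => /eqP.
  by rewrite -subr_eq subrr => /eqP.
elim: s => [|i s IHs]; rewrite ?big_nil // !big_cons.
by case: (P i) => //; rewrite lin IHs.
Qed.

Lemma tens_upd n k (w : seq 'I_l) : (size w <= l)%N ->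
  tens T (dfwith (word_vecs n) (word_vec c (L k) w)) = Fvec T c (upd n k w).
Proof.
move=> wl; congr (tens T _); apply: functional_extensionality_dep => s.
case: dfwithP => [|s' ks]; first by rewrite upd_same.
by rewrite upd_other // eq_sym.
Qed.

Lemma act_Fvec p X n : gl_homog par p X ->
  sm_act T X (Fvec T c n)
  = \sum_(k < N)
      (-1) ^+ (p * \sum_(s < N | (s < k)%N) (hw_par (L s) + count odd_letter (n s)))
      *: tens T (dfwith (word_vecs n) (sm_act (L k) X (word_vecs n k))).
Proof.
move=> Xp; rewrite (ts_act T Xp (fun s => word_vec_homog c (L s) (n s))).
apply: eq_bigr => k _; congr (_ *: _).
(* The two exponents use the parity of each factor and an integer representing it, so they agree
   only modulo 2. *)
rewrite -[LHS]signr_odd -[RHS]signr_odd !oddM; congr (_ ^+ (_ && _)).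
elim/big_rec2: _ => // s x y _ yx; rewrite !oddD yx oddb.
by rewrite oddb.
Qed.

(** The sum over the removed letter is put outermost because the terms of a fixed [j] will cancel
    among themselves. *)
Lemma Egen_Fvec a n : ordered_partition n ->
  sm_act T (Egen F a) (Fvec T c n)
  = \sum_(j | c j == a) \sum_(k < N | j \in (n k : seq _))
      ((-1) ^+ (Fpar par a * \sum_(s < N | (s < k)%N)
                   (hw_par (L s) + count odd_letter (n s)))
       * ((-1) ^+ (Fpar par a * count odd_letter (take (index j (n k)) (n k)))
          * ((-1) ^+ par (lo a)
             * cut_weight par c (lambda k) a (drop (index j (n k)).+1 (n k)))))
      *: Fvec T c (upd n k (rem j (n k))).
Proof.
move=> nP; have un k : uniq (n k).
  by apply: uniq_word; rewrite (perm_uniq nP) enum_uniq.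
rewrite (act_Fvec _ (@gl_homog_Egen F r par a)).
rewrite (exchange_big_dep xpredT) //=; apply: eq_bigr => k _.
rewrite Egen_word_vec // tens_lin scaler_sumr.
rewrite big_mkcond big_uniq //= -big_mkcondr.
rewrite (eq_bigl _ _ (fun j => andbC _ _)).
apply: eq_bigr => j /andP [_ jn]; rewrite scalerA tens_upd //.
by rewrite size_rem // (leq_trans (leq_pred _)) ?size_bseq.
Qed.

Lemma Fvec_weight n : ordered_partition n ->
  has_weight (\sum_(s < N) lambda s - \sum_(i < l) simple_root F (c i))
    (Fvec T c n).
Proof.
move=> nP H Hc; rewrite (act_Fvec _ (gl_homog_cartan par Hc)).
under eq_bigr => k _.
  rewrite mul0n expr0 scale1r (word_vec_weight _ _ _ Hc).
  (* A one-term linear combination serves to pull the scalar out of the k-th slot. *)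
  have /= := @tens_lin (word_vecs n) k _ [:: tt] xpredT
    (fun=> weight_eval (word_weight c (lambda k) (n k)) H)
    (fun=> word_vec c (L k) (n k)).
  rewrite !big_seq1 => ->; rewrite tens_upd ?size_bseq // upd_id; over.
rewrite -scaler_suml; congr (_ *: _).
rewrite /weight_eval exchange_big; apply: eq_bigr => b _ /=.
rewrite -mulr_suml; congr (_ * _).
have -> : \sum_(i < l) simple_root F (c i)
    = \sum_(k < N) \sum_(i <- n k) simple_root F (c i).
  by rewrite -sum_concat (perm_big _ nP) big_enum.
by rewrite -sumrB summxE.
Qed.

End Tensor.

(** * Signs, Bethe equations and singularity *)

Section Singular.
Variables (F : fieldType) (r : nat) (par : 'I_r.+1 -> bool) (N l : nat).
Variables (lambda : 'I_N -> 'rV[F]_r.+1).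
Variable L : forall s, irr_hw_module par (lambda s).
Variable T : tensor_product (fun s => L s : supermodule F par).
Variables (z : 'I_N -> F) (c : 'I_l -> 'I_r) (t : 'I_l -> F).
Implicit Types (n : words N l) (k : 'I_N) (j : 'I_l) (a : 'I_r).

Let odd_letter i := Fpar par (c i).

(** The first two terms are the odd inversions of [j :: concat n]: this is the sign obtained with
    [j] in front of all words, together with the Koszul sign of [n]. *)
Definition removal_sign j n : nat :=
  odd_inv odd_letter (concat n)
  + odd_letter j * count (fun y : 'I_l => (y < j)%N && odd_letter y) (concat n)
  + koszul_exponent L c n.

Lemma koszul_insert j n k q : partition_without j n ->
  koszul_exponent L c (upd n k (insert q j (n k)))
  = (koszul_exponent L c n
     + odd_letter j * \sum_(s < N | (s < k)%N) hw_par (L s))%N.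
Proof.
move=> nP; rewrite /koszul_exponent (bigD1 k) //= [in RHS](bigD1 k) //=.
rewrite [RHS]addnAC; congr (_ + _)%N; last first.
  apply: eq_bigr => k' k'k; apply: eq_bigr => s _.
  by rewrite upd_other.
rewrite big_distrr -big_split /=; apply: eq_bigr => s _.
rewrite upd_same ?size_insert ?(size_without k nP) //.
by rewrite (permP (perm_insert _ _ _)) /= mulnDr addnC mulnC
  [in X in (_ + X)%N]mulnC.
Qed.

(** Modulo 2, the odd letters that E_a passes before reaching [j] compensate the inversions that
    depend on the position of [j] ([odd_inv_insert]), and the highest weight vectors that it passes
    compensate the change of the Koszul exponent. *)
Lemma insertion_sign j n k q : partition_without j n -> (q <= size (n k))%N ->
  let h := upd n k (insert q j (n k)) in
  odd (num_odd_inversions par c h + koszul_exponent L c h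
       + (odd_letter j * \sum_(s < N | (s < k)%N)
                           (hw_par (L s) + count odd_letter (h s))
          + odd_letter j * count odd_letter (take (index j (h k)) (h k))))
  = odd (removal_sign j n).
Proof.
move=> nP qs h; have sl := size_without k nP.
have jn := notin_without k nP.
have hP : ordered_partition h.
  by rewrite /ordered_partition (permPl (perm_concat_insert j q sl)).
rewrite koszul_insert // num_odd_inversionsE // upd_same ?size_insert //.
rewrite index_insert // take_insert //.
have [w1 [w2 [cE cw]]] := concat_upd n k.
have hE : concat h = (w1 ++ take q (n k)) ++ j :: (drop q (n k) ++ w2).
  by rewrite cE ?size_insert // /insert -!catA.
have nE : concat n = (w1 ++ take q (n k)) ++ (drop q (n k) ++ w2).
  by rewrite -{1}(upd_id n k) cE ?size_bseq //
    -[in RHS]catA [in X in _ = _ ++ X]catA cat_take_drop.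
have := partition_without_notin nP.
rewrite nE mem_cat negb_or => /andP [j1 _].
have := odd_inv_insert odd_letter (drop q (n k) ++ w2) j1.
rewrite /removal_sign -hE -nE count_cat cw big_split /=.
have -> : (\sum_(s < N | (s < k)%N) count odd_letter (h s)
    = \sum_(s < N | (s < k)%N) count odd_letter (n s))%N.
  by apply: eq_bigr => s sk; rewrite upd_other // -val_eqE neq_ltn sk.
rewrite !mulnDr !oddD => <-.
by rewrite -!addbA addKb; congr (_ (+) _); rewrite addbC -addbA.
Qed.

(** Inserting into the k-th word changes only the k-th factor of [omega], so [omega_insert] applies
    for each k; the letters other than [j] are distributed over the words of [n]. *)
Lemma omega_insert_sum a j n (szn : partition_without j n) :
  injective t -> (forall i s, t i != z s) ->
  \sum_(k < N) \sum_(q < (size (n k)).+1)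
    omega z t (upd n k (insert q j (n k)))
    * cut_weight par c (lambda k) a (drop q (n k))
  = omega z t n
    * (\sum_(k < N) weight_form par (simple_root F a) (lambda k) / (t j - z k)
       - \sum_(i | i != j)
           weight_form par (simple_root F a) (simple_root F (c i)) / (t j - t i)).
Proof.
move=> tI tz.
have -> : \sum_(i | i != j)
    weight_form par (simple_root F a) (simple_root F (c i)) / (t j - t i)
  = \sum_(k < N) \sum_(i <- n k)
    weight_form par (simple_root F a) (simple_root F (c i)) / (t j - t i).
  rewrite -sum_concat.
  have un : uniq (j :: concat n) by rewrite (perm_uniq szn) enum_uniq.
  rewrite big_uniq /=; last by case/andP: un.
  apply: eq_bigl => i.
  have : i \in j :: concat n by rewrite (perm_mem szn) mem_enum.
  rewrite inE; case: (eqVneq i j) => [->|_ /= ->] //.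
  by rewrite (negPf (partition_without_notin szn)).
rewrite -sumrB mulr_sumr; apply: eq_bigr => k _.
have uk : uniq (j :: n k).
  rewrite /= (notin_without k szn) uniq_word //.
  by have := enum_uniq 'I_l; rewrite -(perm_uniq szn) => /andP [].
have oE := omega_insert
  (fun i => weight_form par (simple_root F a) (simple_root F (c i)))
  (weight_form par (simple_root F a) (lambda k)) tI (tz^~ k) uk.
rewrite /omega [in RHS](bigD1 k) //= [RHS]mulrAC -oE.
rewrite mulr_suml; apply: eq_bigr => q _.
rewrite (bigD1 k) //= upd_same ?size_insert ?(size_without k szn) // [RHS]mulrAC.
by congr (_ * _ * _); apply: eq_bigr => s sk; rewrite upd_other.
Qed.

Lemma koszul_singular : injective t -> (forall i s, t i != z s) ->
  bethe_equations par lambda z c t -> singular (koszul_weight_function T z c t).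
Proof.
move=> tI tz bethe; apply: singular_simple => a.
rewrite /koszul_weight_function linear_sum /=.
under eq_bigr => n nP.
  rewrite !linearZ /= Egen_Fvec // !scaler_sumr.
  under eq_bigr => j _ do
    (rewrite !scaler_sumr; under eq_bigr => k _ do rewrite !scalerA).
  over.
rewrite (exchange_big_dep (fun j => c j == a)) //=; apply: big1 => j /eqP ja.
rewrite (eq_bigl (@ordered_partition N l)); last by move=> n; rewrite ja eqxx andbT.
rewrite (exchange_big_dep xpredT) //=.
under eq_bigr => k _ do rewrite big_insert.
rewrite exchange_big /=; apply: big1 => n nP.
(* For fixed [j] and [n], every insertion returns the same vector after removal of [j], with a
   common sign. *)
rewrite (_ : \sum_k _ = ((-1) ^+ removal_sign j n * (-1) ^+ par (lo a)
   * \sum_(k < N) \sum_(q < (size (n k)).+1)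
    omega z t (upd n k (insert q j (n k)))
    * cut_weight par c (lambda k) a (drop q (n k))) *: Fvec T c n).
  (* As c(j) = a, the j-th Bethe equation equates the two sums whose difference multiplies
     [omega]. *)
  rewrite omega_insert_sum // -ja.
  have := bethe j; rewrite addrC => /eqP; rewrite subr_eq0 => /eqP <-.
  by rewrite subrr !mulr0 scale0r.
rewrite mulr_sumr scaler_suml; apply: eq_bigr => k _.
rewrite mulr_sumr scaler_suml; apply: eq_bigr => -[q /= qs] _.
have sl := size_without k nP; have jn := notin_without k nP.
rewrite upd_upd.
rewrite -[(-1) ^+ removal_sign j n]signr_odd -(insertion_sign nP qs) signr_odd.
rewrite /odd_letter ja !exprD.
have hk : upd n k (insert q j (n k)) k = insert q j (n k) :> seq _.
  by rewrite upd_same ?size_insert.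
rewrite [rem _ _](_ : _ = n k :> seq _) ?upd_id; last by rewrite hk rem_insert.
rewrite [drop _ (upd _ _ _ k)](_ : _ = drop q (n k)); last first.
  by rewrite hk index_insert // drop_insert.
by congr (_ *: _); ring.
Qed.

Lemma koszul_weight :
  has_weight (\sum_(s < N) lambda s - \sum_(i < l) simple_root F (c i))
    (koszul_weight_function T z c t).
Proof.
move=> H Hc; rewrite /koszul_weight_function linear_sum scaler_sumr /=.
apply: eq_bigr => n nP; rewrite !linearZ /= (Fvec_weight T c nP Hc).
by rewrite !scalerA; congr (_ *: _); ring.
Qed.

(** A term of the Koszul exponent pairs v_s with the odd letters of a later word, which is why the
    condition on parities stops before the last factor. *)
Lemma weight_function_koszul :
  (forall (s : 'I_N) (i : 'I_l),
    (s.+1 < N)%N -> Fpar par (c i) -> hw_par (L s) = false) ->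
  koszul_weight_function T z c t = weight_function T z c t.
Proof.
move=> hw; apply: eq_bigr => n _; rewrite [koszul_exponent _ _ _]big1 ?scale1r //.
move=> k _; apply: big1 => s sk.
have sN : (s.+1 < N)%N by apply: leq_ltn_trans sk (ltn_ord k).
have [/hasP [i _ io]|no] := boolP (has (fun i => Fpar par (c i)) (n k)).
  by rewrite (hw s i).
by move: no; rewrite has_count lt0n negbK => /eqP ->; rewrite muln0.
Qed.

End Singular.

Theorem theorem4p3 (R : realType) (m n r : nat) (par : 'I_r.+1 -> bool)
    (h_dim : (m + n)%N = r.+1)
    (h_even : #|[set a | ~~ par a]| = m) (h_odd : #|[set a | par a]| = n)
    (h_first : par ord0 = false)
    (N : nat) (lambda : 'I_N -> 'rV[R[i]]_r.+1)
    (L : forall s, irr_hw_module par (lambda s))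
    (T : tensor_product (fun s => L s : supermodule _ par))
    (z : 'I_N -> R[i]) (h_z : injective z)
    (ell : 'I_r -> nat) (l : nat) (h_l : (\sum_(p < r) ell p)%N = l)
    (c : 'I_l -> 'I_r) (h_c : forall p, #|[set i | c i == p]| = ell p)
    (t : 'I_l -> R[i])
    (h_tt : forall i j, i != j -> t i != t j)
    (h_tz : forall i s, t i != z s)
    (h_bethe : bethe_equations par lambda z c t) :
  let lambda_inf :=
    \sum_(s < N) lambda s - \sum_(p < r) simple_root R[i] p *+ ell p in
  (* the weight function as written *)
  ((forall (s : 'I_N) (i : 'I_l),
      (s.+1 < N)%N -> Fpar par (c i) -> hw_par (L s) = false) ->
    singular (weight_function T z c t) /\
    has_weight lambda_inf (weight_function T z c t)) /\
  (* highest weight vectors of arbitrary parities *)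
  (singular (koszul_weight_function T z c t) /\
   has_weight lambda_inf (koszul_weight_function T z c t)).
Proof.
move=> lambda_inf.
have tI : injective t by move=> i j tij; apply: contra_eq tij; exact: h_tt.
have inf : lambda_inf = \sum_(s < N) lambda s - \sum_(i < l) simple_root _ (c i).
  (* Grouping the letters by their value under [c] gives each simple root the multiplicity
     [ell p]. *)
  congr (_ - _); rewrite (partition_big c xpredT) //=; apply: eq_bigr => p _.
  rewrite (eq_bigr (fun=> simple_root _ p)) => [|i /eqP -> //].
  by rewrite sumr_const -h_c cardsE.
have sing := koszul_singular T tI h_tz h_bethe.
have wt := koszul_weight T z c t; rewrite -inf in wt.
by split=> // hw; rewrite -(weight_function_koszul T z t hw).
Qed.
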